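(* Fix a constant $\kappa>0$. Let $X$ and $Y$ be any two oriented points in $T\mathbb{R}^2$, $X\ne Y$, such that $(X,Y)\in\mathcal{O}$. Then for any $s\geq\ell_m$ there exists a curvature-bounded path $\gamma\in\Gamma(X,Y)$ such that $\ell(\gamma)=s$.
   Context: An oriented point is an element $X=(\boldsymbol{x},\boldsymbol{v})$ of the tangent bundle $T\mathbb{R}^2$, with $\boldsymbol{x}\in\mathbb{R}^2$ and $\boldsymbol{v}$ a (unit) tangent vector at $\boldsymbol{x}$. Fix $\kappa>0$. A curvature-bounded path from $X=(\boldsymbol{x},\boldsymbol{v})$ to $Y=(\boldsymbol{y},\boldsymbol{w})$ is a map $\gamma:[0,s]\to\mathbb{R}^2$ that is $C^1$ and piecewise $C^2$, parameterised by arc length ($\|\gamma'(t)\|=1$ for all $t$), with $\gamma(0)=\boldsymbol{x}$, $\gamma'(0)=\boldsymbol{v}$, $\gamma(s)=\boldsymbol{y}$, $\gamma'(s)=\boldsymbol{w}$, and $\|\gamma''(t)\|\leq\kappa$ wherever $\gamma''(t)$ is defined. For $X\ne Y$, $\Gamma(X,Y)$ is the set of all such paths and $\ell(\gamma)$ is the length of $\gamma$. $\gamma_m$ denotes the shortest path in $\Gamma(X,Y)$ (a fixed one, should there be several) and $\ell_m=\ell(\gamma_m)>0$. $\mathrm{C}_\eta$ is an arc of radian measure $\eta\geq 0$ of a circle of radius $1/\kappa$, right-turning or left-turning; $\mathrm{S}_d$ is a straight line segment of length $d\ge 0$; $\mathrm{C}_\eta\mathrm{S}_d\mathrm{C}_\xi$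 denotes the $C^1$ concatenation of an arc, a segment and an arc. $\boldsymbol{c}_X^r$ and $\boldsymbol{c}_X^l$ are the centers of the circles of radius $1/\kappa$ through $\boldsymbol{x}$, tangent to $\boldsymbol{v}$, lying respectively to the right and to the left of $X$; likewise $\boldsymbol{c}_Y^r,\boldsymbol{c}_Y^l$ for $Y$. Let $d(\cdot,\cdot)$ be the Euclidean distance. $\mathcal{O}\subset(T\mathbb{R}^2)^2$ is the set of $(X,Y)$ such that $\gamma_m$ is of type $\mathrm{C}_\eta\mathrm{S}_d\mathrm{C}_\xi$ and at least one of the following holds: $\eta\geq\pi$; $\xi\geq\pi$; $d\geq 4/\kappa$; $d(\boldsymbol{c}_X^r,\boldsymbol{c}_Y^r)\geq 4/\kappa$; $d(\boldsymbol{c}_X^l,\boldsymbol{c}_Y^l)\geq 4/\kappa$. *)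

(* Defs.v *)
(* Stdlib reals with Coquelicot. *)
From Stdlib Require Import Reals.
From Coquelicot Require Import Coquelicot.
Open Scope R_scope.

(* Coquelicot's [norm] on [R * R] is the Euclidean norm. *)
Definition plane : Type := (R * R)%type.

Definition edist (p q : plane) : R := norm (minus p q : plane).

Record oriented_point : Type := OrientedPoint {
  pos : plane;
  dir : plane;
  dir_unit : norm dir = 1
}.

Definition Icc (a b t : R) : Prop := a <= t <= b.

(* Derivative of the restriction of [f] to [D]: it is one-sided at an endpoint
   when [D] is an interval, and it is [is_derive] when [D] is everything. *)
Definition is_derive_on (D : R -> Prop) (f : R -> plane) (t : R) (l : plane) :
    Prop :=
  filterdiff f (within D (locally t)) (fun h : R => scal h l).

(* Only the values of [traj] and [vel] on [0, dur] are meaningful; there, [vel]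
   is determined by [traj]. *)
Record C1_path : Type := C1Path {
  dur : R;
  traj : R -> plane;
  vel : R -> plane;
  dur_gt0 : 0 < dur;
  vel_derive : forall t, Icc 0 dur t -> is_derive_on (Icc 0 dur) traj t (vel t);
  vel_continuous : continuous_on (Icc 0 dur) vel
}.

Definition path_length (g : C1_path) : R :=
  RInt (fun t => norm (vel g t)) 0 (dur g).

(* On each closed piece the path is C^2 up to the endpoints, with one-sided
   second derivatives there. *)
Definition piecewise_C2 (g : C1_path) : Prop :=
  exists (n : nat) (tau : nat -> R),
    tau 0%nat = 0 /\ tau n = dur g /\
    forall i : nat, (i < n)%nat ->
      tau i < tau (S i) /\
      exists acc : R -> plane,
        continuous_on (Icc (tau i) (tau (S i))) acc /\
        forall t, Icc (tau i) (tau (S i)) t ->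
          is_derive_on (Icc (tau i) (tau (S i))) (vel g) t (acc t).

Definition in_Gamma (kappa : R) (X Y : oriented_point) (g : C1_path) : Prop :=
  piecewise_C2 g /\
  (forall t, Icc 0 (dur g) t -> norm (vel g t) = 1) /\
  traj g 0 = pos X /\ vel g 0 = dir X /\
  traj g (dur g) = pos Y /\ vel g (dur g) = dir Y /\
  (forall t a, Icc 0 (dur g) t ->
     is_derive_on (Icc 0 (dur g)) (vel g) t a -> norm a <= kappa).

Definition is_shortest (kappa : R) (X Y : oriented_point) (g : C1_path) : Prop :=
  in_Gamma kappa X Y g /\
  forall h : C1_path, in_Gamma kappa X Y h -> path_length g <= path_length h.

Inductive turn : Set := Rightward | Leftward.

(* Left-turning is counterclockwise. *)
Definition turn_sign (s : turn) : R :=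
  match s with Rightward => -1 | Leftward => 1 end.

Definition turn_center (kappa : R) (s : turn) (X : oriented_point) : plane :=
  plus (pos X)
       (scal (turn_sign s / kappa) ((- snd (dir X), fst (dir X)) : plane)).

(* From time [a] on, [g] runs at unit speed along an arc of radian measure [eta]
   of a circle of radius [1 / kappa]; [phi] is the polar angle, seen from the
   center [c], of the initial point of the arc. *)
Definition is_arc (kappa : R) (s : turn) (eta a : R) (g : R -> plane) : Prop :=
  exists (c : plane) (phi : R), forall t, Icc a (a + eta / kappa) t ->
    g t = plus c (scal (/ kappa)
            ((cos (phi + turn_sign s * kappa * (t - a)),
              sin (phi + turn_sign s * kappa * (t - a))) : plane)).

Definition is_segment (d a : R) (g : R -> plane) : Prop :=
  exists p u : plane, norm u = 1 /\
    forall t, Icc a (a + d) t -> g t = plus p (scal (t - a) u).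

(* The concatenation is C^1 because [g] is. *)
Definition is_CSC (kappa eta d xi : R) (g : C1_path) : Prop :=
  0 <= eta /\ 0 <= d /\ 0 <= xi /\
  dur g = eta / kappa + d + xi / kappa /\
  exists s1 s2 : turn,
    is_arc kappa s1 eta 0 (traj g) /\
    is_segment d (eta / kappa) (traj g) /\
    is_arc kappa s2 xi (eta / kappa + d) (traj g).

(* [gm] is the chosen shortest path from [X] to [Y]. *)
Definition in_O (kappa : R) (X Y : oriented_point) (gm : C1_path) : Prop :=
  exists eta d xi : R,
    is_CSC kappa eta d xi gm /\
    (PI <= eta \/ PI <= xi \/ 4 / kappa <= d \/
     4 / kappa <= edist (turn_center kappa Rightward X)
                        (turn_center kappa Rightward Y) \/
     4 / kappa <= edist (turn_center kappa Leftward X)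
                        (turn_center kappa Leftward Y)).

(* Main.v *)
(* Put r = 1 / kappa. An arc of angle at least PI can be given any larger length
   by inserting parallel segments before and after its first half turn. In the
   remaining cases two circles on the same side, of sign -sg, have centers at a
   distance D >= 4 r (for a segment of length at least 4 r, those tangent to it at
   its ends). The shortest path is then of the form
     C(-sg, al) C(sg, a) S_d C(sg, b) C(-sg, be)
   with some of the angles equal to 0. Increase a and b by t and solve for al, be
   and d so that the two outer centers stay in place: the segment turns by
   tau t - tau 0, where D * sin (tau t) = 2 r (cos (b + t) - cos (a + t)), so
   al and be increase by t -+ (tau t - tau 0). The bound D >= 4 r makes tau
   well defined and nonexpansive and keeps d >= 0, so all these paths exist. Their
   length varies continuously until a + t or b + t reaches PI, and from there on
   half turns do the rest. *)
Require Import Defs.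
From Stdlib Require Import Reals.
From Stdlib Require Import Lra Lia Psatz.
From Coquelicot Require Import Coquelicot.
Open Scope R_scope.

(** * Gluing *)

Lemma within_proper (D : R -> Prop) (t : R) :
  D t -> ProperFilter' (within D (locally t)).
Proof.
  intros Dt; split.
  - intros H; exact (locally_singleton t _ H Dt).
  - apply within_filter, locally_filter.
Qed.

(** [filterdiff] asks for the estimate at every limit of the filter. As [t] lies in [D], that filter
    is proper and [t] is its only limit. *)
Lemma is_derive_onE (D : R -> Prop) (f : R -> plane) (t : R) (l : plane) :
  D t ->
  (is_derive_on D f t l <->
   forall eps : posreal, within D (locally t) (fun y =>
     norm (minus (minus (f y) (f t)) (scal (y - t) l)) <= eps * Rabs (y - t))).
Proof.
  intros Dt; split.
  - intros [_ H] eps.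
    exact (H t (filter_le_within D) eps).
  - intros H; split.
    { apply (is_linear_scal_l
        (V := prod_NormedModule _ R_NormedModule R_NormedModule) l). }
    intros x Hx eps.
    assert (x = t) as ->.
    { apply (is_filter_lim_unique (FF := within_proper D t Dt)); [exact Hx|].
      exact (filter_le_within D). }
    exact (H eps).
Qed.

Lemma is_derive_on_ext (D : R -> Prop) (f g : R -> plane) (t : R) (l : plane) :
  D t -> (forall y, D y -> f y = g y) ->
  is_derive_on D f t l -> is_derive_on D g t l.
Proof.
  intros Dt Hfg; rewrite !is_derive_onE by exact Dt; intros H eps.
  generalize (H eps); unfold within; apply filter_imp; intros y Hy Dy.
  rewrite <- (Hfg y Dy), <- (Hfg t Dt); auto.
Qed.

Lemma is_derive_on_subset (D E : R -> Prop) (f : R -> plane) (t : R) (l : plane) :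
  E t -> (forall y, E y -> D y) ->
  is_derive_on D f t l -> is_derive_on E f t l.
Proof.
  intros Et HED; rewrite (is_derive_onE D) by auto; rewrite is_derive_onE by auto.
  intros H eps; generalize (H eps); unfold within; apply filter_imp; auto.
Qed.

Lemma locally_shift (c t : R) (P : R -> Prop) :
  locally t P -> locally (t + c) (fun y => P (y - c)).
Proof.
  intros [e He]; exists e; intros y Hy; apply He.
  change (Rabs (y - (t + c)) < e) in Hy; change (Rabs ((y - c) - t) < e).
  replace (y - c - t) with (y - (t + c)) by ring; exact Hy.
Qed.

Lemma within_Icc_shift (a b c t : R) (P : R -> Prop) :
  within (Icc a b) (locally t) P ->
  within (Icc (a + c) (b + c)) (locally (t + c)) (fun y => P (y - c)).
Proof.
  intros H; generalize (locally_shift c t _ H); unfold within.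
  apply filter_imp; intros y Hy [? ?]; apply Hy; split; lra.
Qed.

Lemma is_derive_on_shift (a b c : R) (f : R -> plane) (t : R) (l : plane) :
  Icc a b t -> is_derive_on (Icc a b) f t l ->
  is_derive_on (Icc (a + c) (b + c)) (fun y => f (y - c)) (t + c) l.
Proof.
  intros Ht; rewrite is_derive_onE by exact Ht.
  rewrite is_derive_onE by (destruct Ht; split; lra).
  intros H eps; generalize (within_Icc_shift a b c t _ (H eps)).
  unfold within; apply filter_imp; intros y Hy Dy; specialize (Hy Dy).
  replace (t + c - c) with t by ring.
  replace (y - (t + c)) with (y - c - t) by ring; exact Hy.
Qed.

Lemma continuous_on_shift (a b c : R) (f : R -> plane) :
  continuous_on (Icc a b) f ->
  continuous_on (Icc (a + c) (b + c)) (fun y => f (y - c)).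
Proof.
  intros H x [Hx1 Hx2] P HP.
  replace x with (x - c + c) by ring.
  apply (within_Icc_shift a b c (x - c) (fun y => P (f y))).
  apply (H (x - c)); [split; lra | exact HP].
Qed.

(** Near a [t] other than [b], [Icc a c] coincides with one of the two pieces; at [t = b] both
    hypotheses are available, and each [y] uses the piece containing it. *)
Lemma within_Icc_glue (a b c t : R) (P : R -> Prop) :
  (t <= b -> within (Icc a b) (locally t) P) ->
  (b <= t -> within (Icc b c) (locally t) P) ->
  within (Icc a c) (locally t) P.
Proof.
  unfold within; intros H1 H2; destruct (Rtotal_order t b) as [Hlt | [Heq | Hgt]].
  - generalize (filter_and _ _ (H1 (Rlt_le _ _ Hlt)) (open_lt b t Hlt)).
    apply filter_imp; intros y [Hy Hyb] [? ?]; apply Hy; split; lra.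
  - generalize (filter_and _ _ (H1 (Req_le _ _ Heq)) (H2 (Req_le _ _ (eq_sym Heq)))).
    apply filter_imp; intros y [Hy1 Hy2] [? ?].
    destruct (Rle_dec y b); [apply Hy1 | apply Hy2]; split; lra.
  - generalize (filter_and _ _ (H2 (Rlt_le _ _ Hgt)) (open_gt b t Hgt)).
    apply filter_imp; intros y [Hy Hyb] [? ?]; apply Hy; split; lra.
Qed.

Lemma is_derive_on_glue (a b c : R) (f : R -> plane) (t : R) (l : plane) :
  Icc a c t ->
  (t <= b -> is_derive_on (Icc a b) f t l) ->
  (b <= t -> is_derive_on (Icc b c) f t l) ->
  is_derive_on (Icc a c) f t l.
Proof.
  intros [Hac1 Hac2] H1 H2; rewrite is_derive_onE by (split; lra); intros eps.
  apply within_Icc_glue with b; intros Hb.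
  - assert (Ht : Icc a b t) by (split; lra).
    exact (proj1 (is_derive_onE _ f t l Ht) (H1 Hb) eps).
  - assert (Ht : Icc b c t) by (split; lra).
    exact (proj1 (is_derive_onE _ f t l Ht) (H2 Hb) eps).
Qed.

Lemma continuous_on_glue (a b c : R) (f : R -> plane) :
  continuous_on (Icc a b) f -> continuous_on (Icc b c) f ->
  continuous_on (Icc a c) f.
Proof.
  intros H1 H2 x [Hx1 Hx2] P HP.
  apply within_Icc_glue with b; intros Hb.
  - apply (H1 x); [split; lra | exact HP].
  - apply (H2 x); [split; lra | exact HP].
Qed.

(** The seam [d] takes its value from [f]; statements about the right piece up to the seam therefore
    carry the hypothesis [f d = g 0]. *)
Definition glue (d : R) (f g : R -> plane) (t : R) : plane :=
  if Rle_dec t d then f t else g (t - d).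

Lemma glue_left (d : R) (f g : R -> plane) (t : R) :
  t <= d -> glue d f g t = f t.
Proof. intros H; unfold glue; destruct (Rle_dec t d); [reflexivity | lra]. Qed.

Lemma glue_right (d : R) (f g : R -> plane) (t : R) :
  f d = g 0 -> d <= t -> glue d f g t = g (t - d).
Proof.
  intros Hfg H; unfold glue; destruct (Rle_dec t d) as [H' | H']; [|reflexivity].
  replace t with d by lra; rewrite Hfg; f_equal; ring.
Qed.

Lemma is_derive_on_glue_left (d : R) (f g : R -> plane) (a b t : R) (l : plane) :
  Icc a b t -> b <= d ->
  (is_derive_on (Icc a b) (glue d f g) t l <-> is_derive_on (Icc a b) f t l).
Proof.
  intros Ht Hb; split; apply is_derive_on_ext; try exact Ht;
    intros y [_ Hy]; rewrite glue_left by lra; reflexivity.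
Qed.

(** Used in both directions: to differentiate a glued map, and to carry a derivative of the glued
    velocity back to its piece, where the curvature bound is known. *)
Lemma is_derive_on_glue_right (d : R) (f g : R -> plane) (a b t : R) (l : plane) :
  f d = g 0 -> Icc a b t -> 0 <= a ->
  (is_derive_on (Icc (a + d) (b + d)) (glue d f g) (t + d) l <->
   is_derive_on (Icc a b) g t l).
Proof.
  intros hfg [Ht1 Ht2] Ha; split; intros H.
  - apply (is_derive_on_shift _ _ (- d)) in H; [|split; lra].
    replace (a + d + - d) with a in H by ring.
    replace (b + d + - d) with b in H by ring.
    replace (t + d + - d) with t in H by ring.
    revert H; apply is_derive_on_ext; [split; lra|].
    intros y [Hy1 Hy2]; rewrite glue_right by (auto; lra); f_equal; ring.
  - apply (is_derive_on_shift _ _ d) in H; [|split; lra].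
    revert H; apply is_derive_on_ext; [split; lra|].
    intros y [Hy1 Hy2]; rewrite glue_right by (auto; lra); reflexivity.
Qed.

Lemma is_derive_on_glue_join (d1 d2 : R) (f g f' g' : R -> plane) (t : R) :
  f d1 = g 0 -> f' d1 = g' 0 ->
  (forall u, Icc 0 d1 u -> is_derive_on (Icc 0 d1) f u (f' u)) ->
  (forall u, Icc 0 d2 u -> is_derive_on (Icc 0 d2) g u (g' u)) ->
  Icc 0 (d1 + d2) t ->
  is_derive_on (Icc 0 (d1 + d2)) (glue d1 f g) t (glue d1 f' g' t).
Proof.
  intros hfg Hfg' Hf Hg [Ht1 Ht2].
  apply is_derive_on_glue with d1; try (split; lra); intros H.
  - rewrite glue_left by exact H; apply is_derive_on_glue_left; [split; lra | lra |].
    apply Hf; split; lra.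
  - rewrite glue_right by auto.
    generalize (is_derive_on_glue_right d1 f g 0 d2 (t - d1) (g' (t - d1))).
    replace (0 + d1) with d1 by ring; replace (d2 + d1) with (d1 + d2) by ring.
    replace (t - d1 + d1) with t by ring.
    intros E; apply E; [exact hfg | split; lra | lra |].
    apply Hg; split; lra.
Qed.

Lemma continuous_on_glue_join (d1 d2 : R) (f g : R -> plane) :
  f d1 = g 0 ->
  continuous_on (Icc 0 d1) f -> continuous_on (Icc 0 d2) g ->
  continuous_on (Icc 0 (d1 + d2)) (glue d1 f g).
Proof.
  intros hfg Hf Hg; apply continuous_on_glue with d1.
  - apply continuous_on_ext with f; [|exact Hf].
    intros x [_ Hx]; rewrite glue_left by lra; reflexivity.
  - apply (continuous_on_shift _ _ d1) in Hg.
    replace (0 + d1) with d1 in Hg by ring; replace (d2 + d1) with (d1 + d2) in Hg by ring.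
    revert Hg; apply continuous_on_ext.
    intros x [Hx _]; rewrite glue_right by auto; reflexivity.
Qed.


(** * Concatenation of curvature-bounded paths *)

Lemma telescoping_le (n : nat) (tau : nat -> R) :
  (forall i, (i < n)%nat -> tau i < tau (S i)) ->
  forall i, (i <= n)%nat -> tau 0%nat <= tau i <= tau n.
Proof.
  induction n as [|n IH]; intros H i Hi.
  - replace i with 0%nat by lia; lra.
  - assert (IH' := IH (fun j Hj => H j (Nat.lt_lt_succ_r _ _ Hj))).
    assert (Hn := H n (Nat.lt_succ_diag_r n)).
    destruct (Nat.eq_dec i (S n)) as [-> | Hne].
    + generalize (IH' n (le_n n)); lra.
    + generalize (IH' i ltac:(lia)); lra.
Qed.

Lemma piecewise_C2_concat (g1 g2 g : C1_path) :
  dur g = dur g1 + dur g2 -> vel g1 (dur g1) = vel g2 0 ->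
  vel g = glue (dur g1) (vel g1) (vel g2) ->
  piecewise_C2 g1 -> piecewise_C2 g2 -> piecewise_C2 g.
Proof.
  intros Hd Hv Hg (n1 & tau1 & A0 & A1 & HA) (n2 & tau2 & B0 & B1 & HB).
  (* Monotone breakpoints stay in the parameter interval, so every piece lies on one side of the
     seam. *)
  assert (MA := telescoping_le n1 tau1 (fun i Hi => proj1 (HA i Hi))).
  assert (MB := telescoping_le n2 tau2 (fun i Hi => proj1 (HB i Hi))).
  assert (hd1 := dur_gt0 g1); assert (hd2 := dur_gt0 g2).
  (* The breakpoints of the second path, shifted, follow those of the first. Index [n1] is the seam,
     where both formulas agree, so the acceleration may jump there. *)
  set (tau := fun i => if Compare_dec.le_dec i n1 then tau1 i
                       else tau2 (i - n1)%nat + dur g1).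
  assert (TL : forall i, (i <= n1)%nat -> tau i = tau1 i).
  { intros i Hi; unfold tau; destruct (Compare_dec.le_dec i n1); [reflexivity | lia]. }
  assert (TR : forall i, (n1 <= i)%nat -> tau i = tau2 (i - n1)%nat + dur g1).
  { intros i Hi; unfold tau; destruct (Compare_dec.le_dec i n1); [|reflexivity].
    replace i with n1 by lia; rewrite Nat.sub_diag, A1, B0; ring. }
  exists (n1 + n2)%nat, tau; split; [|split].
  - rewrite TL by lia; exact A0.
  - rewrite TR by lia; replace (n1 + n2 - n1)%nat with n2 by lia; rewrite B1, Hd; ring.
  - intros i Hi; rewrite Hg; destruct (Compare_dec.le_lt_dec n1 i) as [Hi1 | Hi1].
    + rewrite !TR by lia; replace (S i - n1)%nat with (S (i - n1)) by lia.
      destruct (HB (i - n1)%nat ltac:(lia)) as [Hlt (acc & Hc & Hacc)].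
      split; [lra|]; exists (fun t => acc (t - dur g1)); split.
      * apply continuous_on_shift; exact Hc.
      * intros t [Ht1 Ht2]; replace t with (t - dur g1 + dur g1) at 1 by ring.
        apply is_derive_on_glue_right; [exact Hv | split; lra | |].
        -- rewrite <- B0; apply MB; lia.
        -- apply Hacc; split; lra.
    + rewrite !TL by lia.
      destruct (HA i Hi1) as [Hlt (acc & Hc & Hacc)].
      split; [exact Hlt|]; exists acc; split; [exact Hc|].
      intros t Ht; apply is_derive_on_glue_left; [exact Ht | | auto].
      rewrite <- A1; apply MA; lia.
Qed.

Lemma path_length_unit_speed (g : C1_path) :
  (forall t, Icc 0 (dur g) t -> norm (vel g t) = 1) -> path_length g = dur g.
Proof.
  intros H; assert (Hd := dur_gt0 g); unfold path_length.
  rewrite (RInt_ext _ (fun _ => 1)).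
  - rewrite RInt_const; unfold scal; simpl; unfold mult; simpl; ring.
  - rewrite Rmin_left, Rmax_right by lra; intros x Hx; apply H; split; lra.
Qed.

Lemma in_Gamma_length (kappa : R) (X Y : oriented_point) (g : C1_path) :
  in_Gamma kappa X Y g -> path_length g = dur g.
Proof. intros (_ & H & _); apply path_length_unit_speed, H. Qed.

Lemma in_Gamma_concat (kappa : R) (X Y Z : oriented_point) (g1 g2 : C1_path) :
  in_Gamma kappa X Y g1 -> in_Gamma kappa Y Z g2 ->
  exists g, in_Gamma kappa X Z g /\ path_length g = path_length g1 + path_length g2.
Proof.
  intros G1 G2.
  rewrite (in_Gamma_length _ _ _ _ G1), (in_Gamma_length _ _ _ _ G2).
  destruct G1 as (C1 & U1 & P10 & V10 & P11 & V11 & K1).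
  destruct G2 as (C2 & U2 & P20 & V20 & P21 & V21 & K2).
  assert (hd1 := dur_gt0 g1); assert (hd2 := dur_gt0 g2).
  assert (HP : traj g1 (dur g1) = traj g2 0) by congruence.
  assert (HV : vel g1 (dur g1) = vel g2 0) by congruence.
  pose (g := C1Path (dur g1 + dur g2) (glue (dur g1) (traj g1) (traj g2))
    (glue (dur g1) (vel g1) (vel g2)) (Rplus_lt_0_compat _ _ hd1 hd2)
    (fun t Ht => is_derive_on_glue_join (dur g1) (dur g2) _ _ _ _ t HP HV
       (vel_derive g1) (vel_derive g2) Ht)
    (continuous_on_glue_join (dur g1) (dur g2) _ _ HV
       (vel_continuous g1) (vel_continuous g2))).
  assert (G : in_Gamma kappa X Z g).
  { repeat split.
    - apply piecewise_C2_concat with g1 g2; auto.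
    - intros t [Ht1 Ht2]; simpl in *; destruct (Rle_dec t (dur g1)).
      + rewrite glue_left by lra; apply U1; split; lra.
      + rewrite glue_right by (auto; lra); apply U2; split; lra.
    - simpl; rewrite glue_left by lra; exact P10.
    - simpl; rewrite glue_left by lra; exact V10.
    - simpl; rewrite glue_right by (auto; lra); rewrite <- P21; f_equal; ring.
    - simpl; rewrite glue_right by (auto; lra); rewrite <- V21; f_equal; ring.
    (* A derivative on the whole interval is one on each part, so the bound of the part containing
       [t] applies; the seam is counted with the first path. *)
    - intros t a [Ht1 Ht2] H; simpl in *; destruct (Rle_dec t (dur g1)).
      + apply (K1 t); [split; lra|].
        apply (is_derive_on_glue_left (dur g1) (vel g1) (vel g2)); [split; lra | lra |].
        revert H; apply is_derive_on_subset; [split; lra|].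
        intros y [? ?]; split; lra.
      + apply (K2 (t - dur g1)); [split; lra|].
        apply (is_derive_on_glue_right (dur g1) (vel g1) (vel g2));
          [exact HV | split; lra | lra |].
        replace (t - dur g1 + dur g1) with t by ring.
        revert H; apply is_derive_on_subset; [split; lra|].
        intros y [? ?]; split; lra. }
  exists g; split; [exact G | exact (in_Gamma_length _ _ _ _ G)].
Qed.

(** * Paths of constant curvature *)

Lemma plane_norm (x y : R) : norm ((x, y) : plane) = sqrt (x ^ 2 + y ^ 2).
Proof.
  change (sqrt (Rabs x ^ 2 + Rabs y ^ 2) = sqrt (x ^ 2 + y ^ 2)).
  rewrite !pow2_abs; reflexivity.
Qed.

Lemma plane_norm_le (x y : R) : norm ((x, y) : plane) <= Rabs x + Rabs y.
Proof.
  rewrite plane_norm; assert (Hx := Rabs_pos x); assert (Hy := Rabs_pos y).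
  rewrite <- (sqrt_pow2 (Rabs x + Rabs y)) by lra; apply sqrt_le_1_alt.
  rewrite <- (pow2_abs x), <- (pow2_abs y); nra.
Qed.

Lemma plane_norm_scal (h : R) (p : plane) : norm (scal h p) = Rabs h * norm p.
Proof.
  destruct p as [x y]; change (scal h (x, y)) with ((h * x, h * y) : plane).
  rewrite !plane_norm, <- (sqrt_pow2 (Rabs h)), <- sqrt_mult_alt, pow2_abs
    by (try apply pow2_ge_0; apply Rabs_pos).
  f_equal; ring.
Qed.

Lemma plane_norm_minus (p q : plane) : norm (minus p q) <= norm p + norm q.
Proof.
  refine (Rle_trans _ _ _ (norm_triangle p (opp q)) _).
  apply Rplus_le_compat_l, Req_le, (norm_opp q).
Qed.

Lemma is_derive_on_pair (D : R -> Prop) (f1 f2 : R -> R) (t l1 l2 : R) :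
  D t -> is_derive f1 t l1 -> is_derive f2 t l2 ->
  is_derive_on D (fun t => (f1 t, f2 t)) t (l1, l2).
Proof.
  intros Dt [_ H1] [_ H2]; apply is_derive_onE; [exact Dt|]; intros eps.
  assert (He : 0 < eps / 2) by (destruct eps; simpl; lra).
  generalize (filter_and _ _ (H1 t (fun P HP => HP) (mkposreal _ He))
                             (H2 t (fun P HP => HP) (mkposreal _ He))).
  unfold within; apply filter_imp; intros y [Hy1 Hy2] _; simpl in Hy1, Hy2.
  refine (Rle_trans _ _ _ (plane_norm_le _ _) _).
  replace (eps * Rabs (y - t)) with (eps / 2 * Rabs (y - t) + eps / 2 * Rabs (y - t))
    by field.
  exact (Rplus_le_compat _ _ _ _ Hy1 Hy2).
Qed.

Lemma continuous_on_pair (D : R -> Prop) (f1 f2 : R -> R) :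
  (forall t, continuous f1 t) -> (forall t, continuous f2 t) ->
  continuous_on D ((fun t => (f1 t, f2 t)) : R -> plane).
Proof.
  intros H1 H2; apply continuous_on_forall; intros x _ P [e He].
  change (locally x (fun y => P (f1 y, f2 y))).
  assert (K1 : locally x (fun y => ball (f1 x) e (f1 y)))
    by exact (H1 x _ (locally_ball _ e)).
  assert (K2 : locally x (fun y => ball (f2 x) e (f2 y)))
    by exact (H2 x _ (locally_ball _ e)).
  generalize (filter_and _ _ K1 K2).
  apply filter_imp; intros y [Hy1 Hy2]; apply He; split; assumption.
Qed.

(** A nondegenerate interval contains points [y] different from [t] and arbitrarily close to it;
    there the two linear approximations differ by at most [2 * eps * Rabs (y - t)]. *)
Lemma is_derive_on_unique (a b t : R) (f : R -> plane) (l1 l2 : plane) :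
  a < b -> Icc a b t ->
  is_derive_on (Icc a b) f t l1 -> is_derive_on (Icc a b) f t l2 -> l1 = l2.
Proof.
  intros Hab Ht; rewrite !is_derive_onE by exact Ht; intros H1 H2.
  assert (Hle : forall eps : posreal, norm (minus l1 l2) <= 2 * eps).
  { intros eps; destruct (filter_and _ _ (H1 eps) (H2 eps)) as [e He].
    (* The point is taken to the right of [t], or to the left if [t] is the right end. *)
    assert (Hy : exists y, Icc a b y /\ Rabs (y - t) < e /\ 0 < Rabs (y - t)).
    { destruct Ht as [Ht1 Ht2]; destruct e as [e he]; simpl.
      destruct (Rlt_dec t b).
      - exists (t + Rmin (e / 2) (b - t)).
        assert (0 < Rmin (e / 2) (b - t)) by (apply Rmin_pos; lra).
        assert (Rmin (e / 2) (b - t) <= e / 2) by apply Rmin_l.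
        assert (Rmin (e / 2) (b - t) <= b - t) by apply Rmin_r.
        rewrite Rabs_pos_eq by lra; repeat split; lra.
      - exists (t - Rmin (e / 2) (t - a)).
        assert (0 < Rmin (e / 2) (t - a)) by (apply Rmin_pos; lra).
        assert (Rmin (e / 2) (t - a) <= e / 2) by apply Rmin_l.
        assert (Rmin (e / 2) (t - a) <= t - a) by apply Rmin_r.
        rewrite Rabs_left by lra; repeat split; lra. }
    destruct Hy as (y & Dy & Hy1 & Hy2).
    destruct (He y Hy1 Dy) as [K1 K2].
    apply Rmult_le_reg_l with (Rabs (y - t)); [exact Hy2|].
    rewrite <- plane_norm_scal.
    set (u := minus (f y) (f t)) in *.
    replace (scal (y - t) (minus l1 l2)) with
      (minus (minus u (scal (y - t) l2)) (minus u (scal (y - t) l1))).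
    - refine (Rle_trans _ _ _ (plane_norm_minus _ _) _).
      apply Rle_trans with (eps * Rabs (y - t) + eps * Rabs (y - t)); [|lra].
      apply Rplus_le_compat; assumption.
    - clearbody u; destruct u as [u1 u2], l1 as [x1 y1], l2 as [x2 y2].
      apply injective_projections; unfold minus, plus, opp, scal; simpl;
        unfold plus, opp, scal; simpl; unfold mult; simpl; ring. }
  assert (Hz : norm (minus l1 l2) = 0 -> l1 = l2).
  { intros Hz; apply norm_eq_zero in Hz; destruct l1 as [x1 y1], l2 as [x2 y2].
    assert (Hx := f_equal fst Hz); assert (Hy := f_equal snd Hz).
    change (x1 + - x2 = 0) in Hx; change (y1 + - y2 = 0) in Hy; f_equal; lra. }
  apply Hz; clear Hz.
  assert (H0 := norm_ge_0 (minus l1 l2)).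
  destruct (Req_dec (norm (minus l1 l2)) 0) as [Hz | Hz]; [exact Hz|].
  assert (Hp : 0 < norm (minus l1 l2) / 4) by lra.
  specialize (Hle (mkposreal _ Hp)); simpl in Hle; lra.
Qed.

(** A [C1_path] has positive duration, so length [0] is a separate alternative; with it, arcs and
    segments of a word may be trivial. *)
Definition joins (kappa : R) (X Y : oriented_point) (s : R) : Prop :=
  (s = 0 /\ Defs.pos X = Defs.pos Y /\ dir X = dir Y) \/
  exists g, in_Gamma kappa X Y g /\ path_length g = s.

(** Oriented points matter only through position and direction; this avoids comparing the proofs
    [dir_unit]. *)
Lemma in_Gamma_ext (kappa : R) (X X' Y Y' : oriented_point) (g : C1_path) :
  Defs.pos X = Defs.pos X' -> dir X = dir X' ->
  Defs.pos Y = Defs.pos Y' -> dir Y = dir Y' ->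
  in_Gamma kappa X Y g -> in_Gamma kappa X' Y' g.
Proof. intros H1 H2 H3 H4; unfold in_Gamma; rewrite H1, H2, H3, H4; auto. Qed.

Lemma joins_ext (kappa : R) (X X' Y Y' : oriented_point) (s : R) :
  Defs.pos X = Defs.pos X' -> dir X = dir X' ->
  Defs.pos Y = Defs.pos Y' -> dir Y = dir Y' ->
  joins kappa X Y s -> joins kappa X' Y' s.
Proof.
  intros H1 H2 H3 H4 [(-> & Hp & Hd) | (g & G & L)].
  - left; repeat split; congruence.
  - right; exists g; split; [|exact L].
    apply in_Gamma_ext with X Y; assumption.
Qed.

Lemma joins_trans (kappa : R) (X Y Z : oriented_point) (s1 s2 : R) :
  joins kappa X Y s1 -> joins kappa Y Z s2 -> joins kappa X Z (s1 + s2).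
Proof.
  intros [(-> & Hp & Hd) | (g1 & G1 & L1)] H2.
  - rewrite Rplus_0_l; apply joins_ext with Y Z; congruence.
  - destruct H2 as [(-> & Hp & Hd) | (g2 & G2 & L2)]; right.
    + exists g1; split; [|lra]; apply in_Gamma_ext with X Y; auto.
    + destruct (in_Gamma_concat _ _ _ _ _ _ G1 G2) as (g & G & L).
      exists g; split; [exact G | lra].
Qed.

Definition unit_vec (th : R) : plane := (cos th, sin th).

Lemma unit_vec_norm (th : R) : norm (unit_vec th) = 1.
Proof.
  unfold unit_vec; rewrite plane_norm, <- !Rsqr_pow2, Rplus_comm, sin2_cos2.
  exact sqrt_1.
Qed.

Definition heading_point (p : plane) (th : R) : oriented_point :=
  OrientedPoint p (unit_vec th) (unit_vec_norm th).

(** The heading turns at the constant rate [c], so the acceleration has norm [Rabs c]. The values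
    [c = 0] and [c = sg * kappa] give segments and arcs. *)
Lemma joins_constant_curvature (kappa c th l : R) (x y : R -> R) :
  Rabs c <= kappa -> 0 <= l ->
  (forall t, is_derive x t (cos (th + c * t))) ->
  (forall t, is_derive y t (sin (th + c * t))) ->
  joins kappa (heading_point (x 0, y 0) th)
              (heading_point (x l, y l) (th + c * l)) l.
Proof.
  intros Hc Hl Hx Hy; destruct (Req_dec l 0) as [-> | Hl0].
  { left; repeat split; simpl; f_equal; ring. }
  assert (Hlp : 0 < l) by lra; right.
  pose (v := fun t : R => unit_vec (th + c * t)).
  pose (acc := fun t : R => (- (c * sin (th + c * t)), c * cos (th + c * t)) : plane).
  assert (Hv : continuous_on (Icc 0 l) v).
  { apply continuous_on_pair; intros t; apply (ex_derive_continuous (V := R_NormedModule));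
      auto_derive; auto. }
  assert (Hacc : forall t, Icc 0 l t -> is_derive_on (Icc 0 l) v t (acc t)).
  { intros t Ht; apply is_derive_on_pair; [exact Ht | |];
      auto_derive; auto; ring. }
  pose (g := C1Path l (fun t => (x t, y t)) v Hlp
    (fun t Ht => is_derive_on_pair _ _ _ _ _ _ Ht (Hx t) (Hy t)) Hv).
  assert (G : in_Gamma kappa (heading_point (x 0, y 0) th)
                (heading_point (x l, y l) (th + c * l)) g).
  { repeat split.
    - exists 1%nat, (fun i => match i with O => 0 | _ => l end).
      split; [reflexivity | split; [reflexivity|]].
      intros i Hi; replace i with 0%nat by lia; split; [exact Hlp|].
      exists acc; split; [|exact Hacc].
      apply continuous_on_pair; intros t;
        apply (ex_derive_continuous (V := R_NormedModule)); auto_derive; auto.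
    - intros t _; apply unit_vec_norm.
    - simpl; unfold v; f_equal; ring.
    - intros t a Ht Ha; simpl in Ht, Ha.
      (* The bound concerns any derivative [a] of the velocity; uniqueness identifies it with the
         explicit [acc t]. *)
      rewrite (is_derive_on_unique 0 l t v a (acc t) Hlp Ht Ha (Hacc t Ht)).
      unfold acc; rewrite plane_norm.
      replace (_ + _) with (c ^ 2 * (Rsqr (sin (th + c * t)) + Rsqr (cos (th + c * t))))
        by (unfold Rsqr; ring).
      rewrite sin2_cos2, Rmult_1_r, <- pow2_abs, sqrt_pow2 by apply Rabs_pos.
      exact Hc. }
  exists g; split; [exact G | exact (in_Gamma_length _ _ _ _ G)].
Qed.

(** * Words of arcs and segments *)

Definition is_sign (sg : R) : Prop := sg = 1 \/ sg = -1.

(* The point at which the circle of radius [1 / kappa] about [c], traversed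
   counterclockwise for [sg = 1] and clockwise for [sg = -1], has heading [th]. *)
Definition circle_point (kappa sg : R) (c : plane) (th : R) : plane :=
  (fst c + sg / kappa * sin th, snd c - sg / kappa * cos th).

Definition line_point (p : plane) (d th : R) : plane :=
  (fst p + d * cos th, snd p + d * sin th).

(** The length [s] is kept apart from the angle [eta], so that a longer detour with the same ends
    can stand in for the arc. *)
Definition arc_joins (kappa sg eta s : R) : Prop :=
  forall c th, joins kappa (heading_point (circle_point kappa sg c th) th)
    (heading_point (circle_point kappa sg c (th + sg * eta)) (th + sg * eta)) s.

(** The matching of the intermediate headings and positions is left as equations, to be settled by
    trigonometry where pieces are chained. *)
Lemma heading_joins_trans (kappa : R) (X Y : oriented_point) (p p' : plane)
    (th th' s1 s2 s : R) :
  joins kappa X (heading_point p th) s1 -> joins kappa (heading_point p' th') Y s2 ->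
  th = th' -> p = p' -> s1 + s2 = s -> joins kappa X Y s.
Proof.
  intros H1 H2 -> -> <-; exact (joins_trans _ _ _ _ _ _ H1 H2).
Qed.

Lemma joins_segment (kappa d th : R) (p : plane) :
  0 < kappa -> 0 <= d ->
  joins kappa (heading_point p th) (heading_point (line_point p d th) th) d.
Proof.
  intros Hk Hd; destruct p as [p1 p2].
  refine (joins_ext _ _ _ _ _ _ _ _ _ _
    (joins_constant_curvature kappa 0 th d (fun t => p1 + t * cos th)
       (fun t => p2 + t * sin th) _ Hd _ _)); simpl.
  - f_equal; ring.
  - reflexivity.
  - reflexivity.
  - f_equal; ring.
  - rewrite Rabs_R0; lra.
  - intros t; replace (th + 0 * t) with th by ring; auto_derive; auto; ring.
  - intros t; replace (th + 0 * t) with th by ring; auto_derive; auto; ring.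
Qed.

Lemma joins_arc (kappa sg eta : R) :
  0 < kappa -> is_sign sg -> 0 <= eta -> arc_joins kappa sg eta (eta / kappa).
Proof.
  intros Hk Hs He c th; destruct c as [c1 c2].
  assert (Hl : 0 <= eta / kappa) by (apply Rdiv_le_0_compat; lra).
  assert (Hs2 : sg * sg = 1) by (destruct Hs; subst sg; ring).
  assert (E : th + sg * eta = th + sg * kappa * (eta / kappa)) by (field; lra).
  refine (joins_ext _ _ _ _ _ _ _ _ _ _
    (joins_constant_curvature kappa (sg * kappa) th (eta / kappa)
       (fun t => c1 + sg / kappa * sin (th + sg * kappa * t))
       (fun t => c2 - sg / kappa * cos (th + sg * kappa * t)) _ Hl _ _)); simpl.
  - unfold circle_point; simpl; replace (th + sg * kappa * 0) with th by ring; reflexivity.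
  - reflexivity.
  - unfold circle_point; simpl; rewrite <- E; reflexivity.
  - rewrite <- E; reflexivity.
  - rewrite Rabs_mult, (Rabs_pos_eq kappa) by lra.
    destruct Hs; subst sg; unfold Rabs; destruct Rcase_abs; lra.
  - intros t; auto_derive; auto.
    replace (_ * (_ * _)) with (sg * sg * cos (th + sg * kappa * t)) by (field; lra).
    rewrite Hs2; ring.
  - intros t; auto_derive; auto.
    replace (- _) with (sg * sg * sin (th + sg * kappa * t)) by (field; lra).
    rewrite Hs2; ring.
Qed.

Lemma cos_sign (sg x : R) : is_sign sg -> cos (sg * x) = cos x.
Proof.
  intros [-> | ->]; [f_equal; ring|].
  rewrite <- (cos_neg x); f_equal; ring.
Qed.

Lemma sin_sign (sg x : R) : is_sign sg -> sin (sg * x) = sg * sin x.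
Proof.
  intros [-> | ->]; [rewrite !Rmult_1_l; reflexivity|].
  replace (-1 * x) with (- x) by ring; rewrite sin_neg; ring.
Qed.

(* Two parallel segments of equal length, inserted around an initial half turn,
   cancel each other. *)
Lemma long_arc_joins (kappa sg eta s : R) :
  0 < kappa -> is_sign sg -> PI <= eta -> eta / kappa <= s ->
  arc_joins kappa sg eta s.
Proof.
  intros Hk Hs He Hes c th.
  assert (HP := PI_RGT_0).
  (* Each of the two segments takes half of the surplus length. *)
  set (h := (s - eta / kappa) / 2).
  assert (Hh : 0 <= h) by (unfold h; lra).
  assert (J1 := joins_segment kappa h th (circle_point kappa sg c th) Hk Hh).
  assert (J2 := joins_arc kappa sg PI Hk Hs (Rlt_le _ _ HP) (line_point c h th) th).
  assert (J3 := joins_segment kappa h (th + sg * PI)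
    (circle_point kappa sg (line_point c h th) (th + sg * PI)) Hk Hh).
  assert (J4 := joins_arc kappa sg (eta - PI) Hk Hs ltac:(lra) c (th + sg * PI)).
  replace (th + sg * PI + sg * (eta - PI)) with (th + sg * eta) in J4 by ring.
  refine (heading_joins_trans _ _ _ _ _ _ _ _ _ _
    (heading_joins_trans _ _ _ _ _ _ _ _ _ _
      (heading_joins_trans _ _ _ _ _ _ _ _ _ _ J1 J2 _ _ eq_refl) J3 _ _ eq_refl)
    J4 _ _ _); try reflexivity.
  - unfold circle_point, line_point; simpl; f_equal; ring.
  - unfold circle_point, line_point; simpl.
    rewrite cos_plus, sin_plus, cos_sign, sin_sign by exact Hs.
    rewrite cos_PI, sin_PI; f_equal; ring.
  - unfold h; field; lra.
Qed.

(** Components, along the segment and normal to it, of the vector from the first outer center to the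
    last. Neighbouring circles are tangent, with centers [2 / kappa] apart, and the inner centers
    differ by the segment. *)
Definition chord_u (kappa a d b : R) : R := d + 2 / kappa * (sin a + sin b).
Definition chord_v (kappa a b : R) : R := 2 / kappa * (cos a - cos b).

(* [u] and [v] are the coordinates of the displacement in the frame
   consisting of the unit vector of heading [phi] and its [sg]-side normal. *)
Definition displace (sg : R) (c : plane) (phi u v : R) : plane :=
  (fst c + u * cos phi - sg * v * sin phi, snd c + u * sin phi + sg * v * cos phi).

(* The angles [al], [a], [b], [be] have signs [-sg], [sg], [sg], [-sg]; the
   centers [c] and [displace ...] are those of the two outer circles. *)
Lemma word_joins (kappa sg : R) (c : plane) (phi al a d b be la lb s : R) :
  0 < kappa -> is_sign sg -> 0 <= al -> 0 <= d -> 0 <= be ->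
  arc_joins kappa sg a la -> arc_joins kappa sg b lb ->
  s = al / kappa + la + d + lb + be / kappa ->
  let v := phi + sg * (al - a) in
  let w := phi + sg * (b - be) in
  let c' := displace sg c phi (chord_u kappa a d b) (chord_v kappa a b) in
  joins kappa (heading_point (circle_point kappa (- sg) c v) v)
              (heading_point (circle_point kappa (- sg) c' w) w) s.
Proof.
  intros Hk Hs Hal Hd Hbe Ja Jb -> v w c'.
  assert (Hs' : is_sign (- sg)) by (destruct Hs; subst sg; [right | left]; ring).
  assert (Hs2 : sg * sg = 1) by (destruct Hs; subst sg; ring).
  (* Center of the first inner circle, tangent to the outer one at heading [phi - sg * a]; [phi] is
     the heading of the segment, which translates [q] to the second inner center. *)
  pose (q := (fst c - 2 * sg / kappa * sin (phi - sg * a),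
              snd c + 2 * sg / kappa * cos (phi - sg * a)) : plane).
  assert (J1 := joins_arc kappa (- sg) al Hk Hs' Hal c v).
  assert (J2 := Ja q (phi - sg * a)).
  replace (phi - sg * a + sg * a) with phi in J2 by ring.
  assert (J3 := joins_segment kappa d phi (circle_point kappa sg q phi) Hk Hd).
  assert (J4 := Jb (line_point q d phi) phi).
  assert (J5 := joins_arc kappa (- sg) be Hk Hs' Hbe c' (phi + sg * b)).
  replace (phi + sg * b + - sg * be) with w in J5 by (unfold w; ring).
  refine (heading_joins_trans _ _ _ _ _ _ _ _ _ _
   (heading_joins_trans _ _ _ _ _ _ _ _ _ _
    (heading_joins_trans _ _ _ _ _ _ _ _ _ _
      (heading_joins_trans _ _ _ _ _ _ _ _ _ _ J1 J2 _ _ eq_refl) J3 _ _ eq_refl)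
    J4 _ _ eq_refl) J5 _ _ eq_refl); try reflexivity.
  - unfold v; ring.
  - replace (v + - sg * al) with (phi - sg * a) by (unfold v; ring).
    unfold q, circle_point; simpl; f_equal; field; lra.
  - unfold circle_point, line_point; simpl; f_equal; ring.
  - unfold c', displace, chord_u, chord_v, line_point, q, circle_point; simpl.
    rewrite cos_plus, sin_plus, cos_minus, sin_minus, !cos_sign, !sin_sign by exact Hs.
    destruct Hs; subst sg; f_equal; field; lra.
Qed.

(** * The deformation *)

Lemma is_derive_asin (x : R) : -1 < x < 1 -> is_derive asin x (/ sqrt (1 - x ^ 2)).
Proof.
  intros Hx; rewrite is_derive_Reals.
  replace (/ sqrt (1 - x ^ 2)) with (derive_pt asin x (derivable_pt_asin x Hx)).
  - apply derive_pt_eq_1 with (derivable_pt_asin x Hx); reflexivity.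
  - rewrite derive_pt_asin, Rsqr_pow2; apply Rmult_1_l.
Qed.

Lemma Rabs_scaled_sin_lt_1 (lam y : R) : Rabs lam < 1 -> -1 < lam * sin y < 1.
Proof.
  intros Hl; assert (H : Rabs (lam * sin y) < 1); [|apply Rabs_def2 in H; lra].
  rewrite Rabs_mult; apply Rle_lt_trans with (Rabs lam * 1); [|lra].
  apply Rmult_le_compat_l; [apply Rabs_pos | apply Rabs_le, SIN_bound].
Qed.

Lemma is_derive_asin_scaled_sin (lam y : R) :
  Rabs lam < 1 ->
  is_derive (fun y => asin (lam * sin y)) y
    (lam * cos y / sqrt (1 - (lam * sin y) ^ 2)).
Proof.
  intros Hl.
  replace (lam * cos y / _) with
    (scal (lam * cos y) (/ sqrt (1 - (lam * sin y) ^ 2))) by reflexivity.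
  apply (is_derive_comp asin (fun y => lam * sin y)).
  - apply is_derive_asin, Rabs_scaled_sin_lt_1, Hl.
  - auto_derive; auto; ring.
Qed.

(** The derivative is at most [1] in absolute value, because [(lam * cos z) ^ 2 + (lam * sin z) ^ 2
    = lam ^ 2 < 1]. *)
Lemma asin_scaled_sin_lipschitz (lam x y : R) :
  Rabs lam < 1 ->
  Rabs (asin (lam * sin y) - asin (lam * sin x)) <= Rabs (y - x).
Proof.
  intros Hl.
  destruct (MVT_gen (fun y => asin (lam * sin y)) x y
    (fun y => lam * cos y / sqrt (1 - (lam * sin y) ^ 2))) as (z & _ & ->).
  - intros z _; apply is_derive_asin_scaled_sin, Hl.
  - intros z _; apply derivable_continuous_pt.
    eexists; apply is_derive_Reals, is_derive_asin_scaled_sin, Hl.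
  - rewrite Rabs_mult; apply Rle_trans with (1 * Rabs (y - x)); [|lra].
    apply Rmult_le_compat_r; [apply Rabs_pos|].
    assert (Hz := Rabs_scaled_sin_lt_1 lam z Hl).
    assert (Hp : 0 < sqrt (1 - (lam * sin z) ^ 2)) by (apply sqrt_lt_R0; nra).
    unfold Rdiv; rewrite Rabs_mult, Rabs_inv, (Rabs_pos_eq (sqrt _)) by lra.
    apply Rmult_le_reg_r with (sqrt (1 - (lam * sin z) ^ 2)); [exact Hp|].
    rewrite Rmult_assoc, Rinv_l, Rmult_1_r, Rmult_1_l by lra.
    rewrite <- (sqrt_pow2 (Rabs _)) by apply Rabs_pos.
    apply sqrt_le_1_alt; rewrite pow2_abs.
    assert (E := sin2_cos2 z); unfold Rsqr in E.
    apply Rabs_def2 in Hl; nra.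
Qed.

(* [D] is the distance between the two outer centers and [- tau t] the angle
   from the line joining them to the segment of the [t]-th path. Since
   [16 * r ^ 2 <= D ^ 2], [sin (tau t)] is a multiple of [sin ((a + b) / 2 + t)]
   by a factor smaller than [1], hence [tau] is nonexpansive. *)
Lemma exists_segment_angle (r a b U : R) :
  0 < r -> 0 <= a < PI -> 0 <= b < PI -> 0 <= U ->
  16 * r ^ 2 <= U ^ 2 + (2 * r * (cos a - cos b)) ^ 2 ->
  exists (D : R) (tau : R -> R),
    continuity tau /\ D * cos (tau 0) = U /\
    forall t, D * sin (tau t) = - (2 * r * (cos (a + t) - cos (b + t))) /\
      2 * r * (sin (a + t) + sin (b + t)) <= D * cos (tau t) /\
      Rabs (tau t - tau 0) <= Rabs t.
Proof.
  intros Hr Ha Hb HU HD.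
  set (D := sqrt (U ^ 2 + (2 * r * (cos a - cos b)) ^ 2)).
  assert (HD2 : D ^ 2 = U ^ 2 + (2 * r * (cos a - cos b)) ^ 2)
    by (apply pow2_sqrt; nra).
  assert (HD0 : 0 <= D) by apply sqrt_pos.
  assert (HD4 : 4 * r <= D) by nra.
  (* The difference [cos (b + t) - cos (a + t)] is [-2 * sin ((b - a) / 2) * sin ((b + a) / 2 + t)];
     [lam] collects the factors independent of [t]. *)
  set (lam := 2 * r / D * (-2 * sin ((b - a) / 2))).
  assert (Hlam : Rabs lam < 1).
  { assert (Hs1 : sin ((b - a) / 2) < sin (PI / 2)) by (apply sin_increasing_1; lra).
    assert (Hs2 : sin (- (PI / 2)) < sin ((b - a) / 2)) by (apply sin_increasing_1; lra).
    rewrite sin_neg in Hs2; rewrite sin_PI2 in Hs1, Hs2.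
    apply Rabs_def1; apply Rmult_lt_reg_l with D; try lra; unfold lam;
      replace (D * (2 * r / D * (-2 * sin ((b - a) / 2))))
        with (- (4 * r * sin ((b - a) / 2))) by (field; lra); nra. }
  set (tau := fun t => asin (lam * sin ((b + a) / 2 + t))).
  assert (Hsin : forall t, D * sin (tau t) = - (2 * r * (cos (a + t) - cos (b + t)))).
  { intros t; unfold tau; rewrite sin_asin
      by (generalize (Rabs_scaled_sin_lt_1 lam ((b + a) / 2 + t) Hlam); lra).
    replace (- (2 * r * (cos (a + t) - cos (b + t))))
      with (2 * r * (cos (b + t) - cos (a + t))) by ring.
    rewrite form2; unfold lam.
    replace ((b + t - (a + t)) / 2) with ((b - a) / 2) by field.
    replace ((b + t + (a + t)) / 2) with ((b + a) / 2 + t) by field.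
    field; lra. }
  assert (Hcos0 : forall t, 0 <= D * cos (tau t)).
  { intros t; apply Rmult_le_pos; [exact HD0|].
    generalize (asin_bound (lam * sin ((b + a) / 2 + t))); intros [? ?].
    apply cos_ge_0; unfold tau; lra. }
  assert (Hcos2 : forall t, (D * cos (tau t)) ^ 2 =
      D ^ 2 - (2 * r * (cos (a + t) - cos (b + t))) ^ 2).
  { intros t; assert (E := sin2_cos2 (tau t)); unfold Rsqr in E.
    replace ((2 * r * (cos (a + t) - cos (b + t))) ^ 2)
      with ((D * sin (tau t)) ^ 2) by (rewrite Hsin; ring).
    nra. }
  exists D, tau; split; [|split].
  - intros t; apply derivable_continuous_pt; eexists.
    apply is_derive_Reals; unfold tau.
    apply (is_derive_comp (fun y => asin (lam * sin y)) (fun t => (b + a) / 2 + t)).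
    + apply is_derive_asin_scaled_sin, Hlam.
    + auto_derive; auto.
  (* [asin] takes its values where the cosine is nonnegative, so [D * cos (tau 0)] and [U] are both
     the nonnegative root of the same square. *)
  - apply Rsqr_inj; [apply Hcos0 | exact HU |].
    rewrite !Rsqr_pow2, Hcos2, HD2, !Rplus_0_r; ring.
  - intros t; split; [apply Hsin | split].
    + apply Rsqr_incr_0_var; [|apply Hcos0].
      rewrite !Rsqr_pow2, Hcos2, HD2.
      assert (Ea := sin2_cos2 (a + t)); assert (Eb := sin2_cos2 (b + t)).
      assert (Hc := proj1 (COS_bound ((a + t) + (b + t)))).
      rewrite cos_plus in Hc; unfold Rsqr in Ea, Eb.
      set (sa := sin (a + t)) in *; set (ca := cos (a + t)) in *.
      set (sb := sin (b + t)) in *; set (cb := cos (b + t)) in *.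
      (* The left side is [2 - 2 * cos (a + b + 2 * t)]; multiplied by [4 * r ^ 2] it is at most
         [16 * r ^ 2 <= D ^ 2]. *)
      assert (Hle : (sa + sb) ^ 2 + (ca - cb) ^ 2 <= 4) by nra.
      assert (Hr2 : 0 <= r ^ 2) by apply pow2_ge_0.
      nra.
    + generalize (asin_scaled_sin_lipschitz lam ((b + a) / 2 + 0) ((b + a) / 2 + t) Hlam).
      fold (tau t) (tau 0); intros H; refine (Rle_trans _ _ _ H (Req_le _ _ _)).
      f_equal; ring.
Qed.

(** Lengths up to that of the deformed path with an inner angle [PI] come from the intermediate
    value theorem, longer ones from a half turn in that path. If [a] or [b] is already [PI], the
    half turn is there from the start. *)
Lemma word_length_unbounded (kappa sg : R) (c : plane) (phi al a d b be s : R) :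
  0 < kappa -> is_sign sg -> 0 <= al -> 0 <= a <= PI -> 0 <= d ->
  0 <= b <= PI -> 0 <= be ->
  (4 / kappa) ^ 2 <= chord_u kappa a d b ^ 2 + chord_v kappa a b ^ 2 ->
  al / kappa + a / kappa + d + b / kappa + be / kappa <= s ->
  let v := phi + sg * (al - a) in
  let w := phi + sg * (b - be) in
  let c' := displace sg c phi (chord_u kappa a d b) (chord_v kappa a b) in
  joins kappa (heading_point (circle_point kappa (- sg) c v) v)
              (heading_point (circle_point kappa (- sg) c' w) w) s.
Proof.
  intros Hk Hs Hal Ha Hd Hb Hbe HD HL v w c'.
  assert (Hr : 0 < / kappa) by (apply Rinv_0_lt_compat, Hk).
  destruct (Rle_lt_dec PI a) as [Ha' | Ha'].
  { apply (word_joins kappa sg c phi al a d b be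
      (s - (al / kappa + d + b / kappa + be / kappa)) (b / kappa)); auto; try lra.
    - apply long_arc_joins; auto; lra.
    - apply joins_arc; auto; lra. }
  destruct (Rle_lt_dec PI b) as [Hb' | Hb'].
  { apply (word_joins kappa sg c phi al a d b be
      (a / kappa) (s - (al / kappa + a / kappa + d + be / kappa))); auto; try lra.
    - apply joins_arc; auto; lra.
    - apply long_arc_joins; auto; lra. }
  assert (HU : 0 <= chord_u kappa a d b).
  { assert (Hsa : 0 <= sin a) by (apply sin_ge_0; lra).
    assert (Hsb : 0 <= sin b) by (apply sin_ge_0; lra).
    unfold chord_u, Rdiv; nra. }
  destruct (exists_segment_angle (/ kappa) a b (chord_u kappa a d b) Hr
    ltac:(lra) ltac:(lra) HU) as (D & tau & Hc & H0 & Ht).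
  { unfold chord_v, Rdiv in HD; nra. }
  (* Chosen so that the chord along the segment becomes [D * cos (tau t)]. *)
  set (d' := fun t => D * cos (tau t) - 2 / kappa * (sin (a + t) + sin (b + t))).
  assert (Hd' : forall t, 0 <= d' t).
  { intros t; destruct (Ht t) as (_ & H & _); unfold d', Rdiv; lra. }
  assert (Hd0 : d' 0 = d).
  { unfold d'; rewrite H0, !Rplus_0_r; unfold chord_u; ring. }
  (* The four angles grow by [4 * t] in total: the turn of the segment adds to one outer arc what it
     takes from the other. *)
  set (len := fun t => (al + a + b + be) / kappa + 4 * t / kappa + d' t).
  (* The [t]-th path: the outer centers, hence both ends, stay in place. *)
  assert (J : forall t la lb, 0 <= t ->
    arc_joins kappa sg (a + t) la -> arc_joins kappa sg (b + t) lb ->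
    joins kappa (heading_point (circle_point kappa (- sg) c v) v)
      (heading_point (circle_point kappa (- sg) c' w) w)
      ((al + be + 2 * t) / kappa + la + d' t + lb)).
  { intros t la lb Ht0 Ja Jb.
    destruct (Ht t) as (HV & _ & HL1); destruct (Ht 0) as (HV0 & _ & _).
    (* Since [tau] moves by at most [t], both outer angles [al + t - (tau t - tau 0)] and
       [be + t + (tau t - tau 0)] stay nonnegative. *)
    rewrite (Rabs_pos_eq t) in HL1 by exact Ht0; apply Rabs_le_between in HL1.
    generalize (word_joins kappa sg c (phi + sg * (tau t - tau 0))
      (al + t - (tau t - tau 0)) (a + t) (d' t) (b + t) (be + t + (tau t - tau 0))
      la lb _ Hk Hs ltac:(lra) (Hd' t) ltac:(lra) Ja Jb eq_refl).
    cbv zeta.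
    replace (phi + sg * (tau t - tau 0) + sg * (al + t - (tau t - tau 0) - (a + t)))
      with v by (unfold v; ring).
    replace (phi + sg * (tau t - tau 0) + sg * (b + t - (be + t + (tau t - tau 0))))
      with w by (unfold w; ring).
    replace (displace _ _ (phi + _) _ _) with c'.
    - replace (_ + _) with ((al + be + 2 * t) / kappa + la + d' t + lb) by (field; lra).
      auto.
    - unfold c'; rewrite <- H0.
      replace (chord_v kappa a b) with (- (D * sin (tau 0)))
        by (rewrite HV0, !Rplus_0_r; unfold chord_v, Rdiv; ring).
      replace (chord_v kappa (a + t) (b + t)) with (- (D * sin (tau t)))
        by (rewrite HV; unfold chord_v, Rdiv; ring).
      replace (chord_u kappa (a + t) (d' t) (b + t)) with (D * cos (tau t))
        by (unfold chord_u, d'; ring).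
      (* [psi] is the heading of the line of centers. In a frame turned from it by [sg * x], the
         vector between the centers has coordinates [D * cos x] and [- (D * sin x)], whatever [x]
         is. *)
      set (psi := phi - sg * tau 0).
      replace (phi + sg * (tau t - tau 0)) with (psi + sg * tau t) by (unfold psi; ring).
      assert (E : forall x,  displace sg c (psi + sg * x) (D * cos x) (- (D * sin x)) =
        (fst c + D * cos psi, snd c + D * sin psi)).
      { intros x; unfold displace.
        assert (Ex := sin2_cos2 x); unfold Rsqr in Ex.
        rewrite cos_plus, sin_plus, cos_sign, sin_sign by exact Hs.
        destruct Hs; subst sg; f_equal;
          [ transitivity (fst c + D * cos psi * (sin x * sin x + cos x * cos x))
          | transitivity (snd c + D * sin psi * (sin x * sin x + cos x * cos x))
          | transitivity (fst c + D * cos psi * (sin x * sin x + cos x * cos x))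
          | transitivity (snd c + D * sin psi * (sin x * sin x + cos x * cos x)) ];
          try (rewrite Ex; ring); ring. }
      rewrite (E (tau t)), <- (E (tau 0)); f_equal; unfold psi; ring. }
  (* The first time at which an inner angle reaches [PI]. *)
  set (T := PI - Rmax a b).
  assert (HTa := Rmax_l a b); assert (HTb := Rmax_r a b).
  assert (HT : 0 < T) by (unfold T; apply Rmax_case; lra).
  destruct (Rle_lt_dec s (len T)) as [HsT | HsT].
  - destruct (IVT_gen len 0 T s) as (t & Ht0 & <-).
    + unfold len, d'; reg.
    + assert (L0 : len 0 <= s) by (unfold len; rewrite Hd0; unfold Rdiv in *; lra).
      rewrite Rmin_left, Rmax_right by lra; lra.
    + rewrite Rmin_left, Rmax_right in Ht0 by lra; unfold len.
      replace (_ + _) with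
        ((al + be + 2 * t) / kappa + (a + t) / kappa + d' t + (b + t) / kappa)
        by (field; lra).
      apply J; [lra | |]; apply joins_arc; auto; lra.
  - assert (HM : PI <= a + T \/ PI <= b + T).
    { unfold T; apply Rmax_case; [left | right]; lra. }
    (* The surplus goes to an inner arc whose angle is now at least [PI]. *)
    set (e := s - len T).
    destruct HM as [HM | HM].
    + replace s with ((al + be + 2 * T) / kappa + ((a + T) / kappa + e) + d' T
        + (b + T) / kappa) by (unfold e, len; field; lra).
      apply J; [lra | apply long_arc_joins | apply joins_arc]; auto; unfold e; lra.
    + replace s with ((al + be + 2 * T) / kappa + (a + T) / kappa + d' T
        + ((b + T) / kappa + e)) by (unfold e, len; field; lra).
      apply J; [lra | apply joins_arc | apply long_arc_joins]; auto; unfold e; lra.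
Qed.

(** * Reading off the word of a path *)

Lemma exists_heading (u : plane) : norm u = 1 -> exists th, u = unit_vec th.
Proof.
  destruct u as [x y]; rewrite plane_norm; intros H.
  assert (Hxy : x ^ 2 + y ^ 2 = 1).
  { rewrite <- (pow2_sqrt (x ^ 2 + y ^ 2)) by nra; rewrite H; ring. }
  assert (Hx : -1 <= x <= 1) by (split; nra).
  assert (Hs : sqrt (1 - x ^ 2) = Rabs y).
  { rewrite <- (sqrt_pow2 (Rabs y)) by apply Rabs_pos; rewrite pow2_abs; f_equal; lra. }
  unfold unit_vec; destruct (Rle_lt_dec 0 y).
  - exists (acos x); rewrite cos_acos, sin_acos, Rsqr_pow2, Hs, Rabs_pos_eq by lra.
    reflexivity.
  - exists (- acos x); rewrite cos_neg, sin_neg, cos_acos, sin_acos, Rsqr_pow2, Hs by lra.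
    rewrite Rabs_left, Ropp_involutive by lra; reflexivity.
Qed.

(** A one-sided derivative on a nondegenerate interval is unique, so a formula for [traj] on a piece
    yields [vel] up to both ends of the piece. *)
Lemma vel_of_traj (g : C1_path) (a b : R) (f f' : R -> plane) (t : R) :
  0 <= a -> a < b -> b <= dur g -> Icc a b t ->
  (forall t, Icc a b t -> traj g t = f t) ->
  is_derive_on (Icc a b) f t (f' t) -> vel g t = f' t.
Proof.
  intros Ha Hab Hb Ht Hf Hd.
  apply (is_derive_on_unique a b t f); [exact Hab | exact Ht | | exact Hd].
  apply is_derive_on_ext with (traj g); [exact Ht | exact Hf |].
  apply is_derive_on_subset with (Icc 0 (dur g)); [exact Ht | |].
  - intros y [? ?]; split; lra.
  - apply vel_derive; destruct Ht; split; lra.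
Qed.

Lemma turn_is_sign (s : turn) : is_sign (turn_sign s).
Proof. destruct s; [right | left]; reflexivity. Qed.

(** Passes from the polar angle of [is_arc] to the heading used by [circle_point], so that
    consecutive pieces can be matched by their headings. *)
Lemma arc_endpoint (kappa : R) (s : turn) (eta a th : R) (g : C1_path) :
  0 < kappa -> 0 <= eta -> 0 <= a -> a + eta / kappa <= dur g ->
  is_arc kappa s eta a (traj g) -> vel g a = unit_vec th ->
  exists c, traj g a = circle_point kappa (turn_sign s) c th /\
    traj g (a + eta / kappa) =
      circle_point kappa (turn_sign s) c (th + turn_sign s * eta) /\
    vel g (a + eta / kappa) = unit_vec (th + turn_sign s * eta).
Proof.
  intros Hk He Ha Hdur (c & phi & Harc) Hv.
  assert (Hs := turn_is_sign s); set (sg := turn_sign s) in *.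
  assert (Hs2 : sg * sg = 1) by (destruct Hs as [-> | ->]; ring).
  (* A trivial arc is a single point and leaves the center given by [is_arc] undetermined; a center
     is rebuilt from position and heading. *)
  destruct (Req_dec eta 0) as [-> | He0].
  { replace (a + 0 / kappa) with a by (field; lra).
    replace (th + sg * 0) with th by ring.
    exists (fst (traj g a) - sg / kappa * sin th, snd (traj g a) + sg / kappa * cos th).
    assert (E : traj g a = circle_point kappa sg (fst (traj g a) - sg / kappa * sin th,
      snd (traj g a) + sg / kappa * cos th) th).
    { unfold circle_point; destruct (traj g a) as [x y]; simpl; f_equal; ring. }
    split; [exact E | split; [exact E | exact Hv]]. }
  assert (Hl : 0 < eta / kappa) by (apply Rdiv_lt_0_compat; lra).
  set (b := a + eta / kappa) in *.
  assert (Hvel : forall t, Icc a b t -> vel g t =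
    (- (sg * sin (phi + sg * kappa * (t - a))), sg * cos (phi + sg * kappa * (t - a)))).
  { intros t Ht; refine (vel_of_traj g a b _ (fun t =>
      (- (sg * sin (phi + sg * kappa * (t - a))),
      sg * cos (phi + sg * kappa * (t - a)))) t Ha _ Hdur Ht Harc _); [unfold b; lra|].
    destruct c as [c1 c2].
    apply (is_derive_on_pair _
      (fun t => c1 + / kappa * cos (phi + sg * kappa * (t - a)))
      (fun t => c2 + / kappa * sin (phi + sg * kappa * (t - a)))); [exact Ht | |];
      auto_derive; auto; fold (t - a); field; lra. }
  assert (Ia : Icc a b a) by (unfold b; split; lra).
  assert (Ib : Icc a b b) by (unfold b; split; lra).
  assert (Eb : phi + sg * kappa * (b - a) = phi + sg * eta) by (unfold b; field; lra).
  assert (Ea : phi + sg * kappa * (a - a) = phi) by ring.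
  rewrite (Hvel a Ia), Ea in Hv.
  (* The heading is the polar angle advanced by a quarter turn in the sense [sg]. *)
  assert (Hcos : - (sg * sin phi) = cos th) by exact (f_equal fst Hv).
  assert (Hsin : sg * cos phi = sin th) by exact (f_equal snd Hv).
  exists c; destruct c as [c1 c2]; split; [|split].
  - rewrite (Harc a Ia); fold sg; rewrite Ea; unfold circle_point.
    rewrite <- Hcos, <- Hsin.
    apply injective_projections; simpl; unfold plus, scal; simpl; unfold mult; simpl.
    + replace (sg / kappa * (sg * cos phi)) with (sg * sg * / kappa * cos phi)
        by (field; lra); rewrite Hs2; ring.
    + replace (sg / kappa * - (sg * sin phi)) with (- (sg * sg * / kappa * sin phi))
        by (field; lra); rewrite Hs2; ring.
  - rewrite (Harc b Ib); fold sg; rewrite Eb; unfold circle_point.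
    rewrite !cos_plus, !sin_plus, <- Hcos, <- Hsin.
    apply injective_projections; simpl; unfold plus, scal; simpl; unfold mult; simpl;
      rewrite ?cos_sign, ?sin_sign by exact Hs; destruct Hs as [Hs | Hs]; rewrite Hs;
      field; lra.
  - rewrite (Hvel b Ib), Eb; unfold unit_vec.
    rewrite !cos_plus, !sin_plus, <- Hcos, <- Hsin.
    rewrite ?cos_sign, ?sin_sign by exact Hs; destruct Hs as [Hs | Hs]; rewrite Hs;
      f_equal; ring.
Qed.

Lemma segment_endpoint (d a th : R) (g : C1_path) :
  0 <= d -> 0 <= a -> a + d <= dur g ->
  is_segment d a (traj g) -> vel g a = unit_vec th ->
  traj g (a + d) = line_point (traj g a) d th /\ vel g (a + d) = unit_vec th.
Proof.
  intros Hd Ha Hdur (p & u & _ & Hseg) Hv.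
  (* A trivial segment says nothing about its direction [u], but both claims then hold at the
     starting point. *)
  destruct (Req_dec d 0) as [-> | Hd0].
  { rewrite Rplus_0_r; split; [|exact Hv].
    unfold line_point; destruct (traj g a) as [x y]; simpl; f_equal; ring. }
  assert (Hvel : forall t, Icc a (a + d) t -> vel g t = u).
  { intros t Ht; refine (vel_of_traj g a (a + d) _ (fun _ => u) t Ha _ Hdur Ht Hseg _);
      [lra|].
    destruct p as [p1 p2], u as [u1 u2].
    apply (is_derive_on_pair _ (fun t => p1 + (t - a) * u1) (fun t => p2 + (t - a) * u2));
      [exact Ht | |]; auto_derive; auto; ring. }
  assert (Ia : Icc a (a + d) a) by (split; lra).
  assert (Ib : Icc a (a + d) (a + d)) by (split; lra).
  rewrite (Hvel a Ia) in Hv; rewrite (Hvel _ Ib), (Hseg a Ia), (Hseg _ Ib), Hv.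
  split; [|reflexivity].
  destruct p as [p1 p2]; unfold line_point, unit_vec.
  apply injective_projections; simpl; unfold plus, scal; simpl; unfold mult; simpl; ring.
Qed.

(** * Far turning centers and long segments *)

Lemma circle_point_turn_center (kappa : R) (s : turn) (X : oriented_point) (th : R) :
  dir X = unit_vec th ->
  circle_point kappa (turn_sign s) (turn_center kappa s X) th = Defs.pos X.
Proof.
  intros H; unfold turn_center, circle_point; rewrite H; destruct (Defs.pos X) as [x y].
  apply injective_projections; simpl; unfold plus, scal; simpl; unfold mult; simpl; ring.
Qed.

Lemma edist_displace (sg : R) (c : plane) (phi u v : R) :
  is_sign sg -> edist c (displace sg c phi u v) ^ 2 = u ^ 2 + v ^ 2.
Proof.
  intros Hs; assert (Hs2 : sg * sg = 1) by (destruct Hs as [-> | ->]; ring).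
  destruct c as [x y]; unfold edist, displace; simpl fst; simpl snd.
  set (p := minus _ _); replace p with
    ((sg * v * sin phi - u * cos phi, - (u * sin phi) - sg * v * cos phi) : plane).
  - rewrite plane_norm, pow2_sqrt by nra.
    assert (E := sin2_cos2 phi); unfold Rsqr in E.
    transitivity ((u ^ 2 + sg * sg * v ^ 2) * (sin phi * sin phi + cos phi * cos phi));
      [ring | rewrite E, Hs2; ring].
  - unfold p; apply injective_projections; simpl; unfold minus, plus, opp; simpl;
      unfold plus, opp; simpl; ring.
Qed.

Lemma joins_of_heading (kappa : R) (X Y : oriented_point) (p q : plane) (v w s : R) :
  p = Defs.pos X -> unit_vec v = dir X -> q = Defs.pos Y -> unit_vec w = dir Y ->
  joins kappa (heading_point p v) (heading_point q w) s -> joins kappa X Y s.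
Proof. intros H1 H2 H3 H4; apply joins_ext; assumption. Qed.

(** The path is read as a five-piece word whose outer circles turn like [T]. An arc turning like [T]
    is an outer one next to an inner angle [0]; any other arc is an inner one next to an outer angle
    [0]. The outer centers are then the [T]-side centers of [X] and [Y]. *)
Lemma joins_of_far_centers (kappa : R) (T s1 s2 : turn) (X Y : oriented_point)
    (c1 c2 : plane) (eta d xi phi s : R) :
  0 < kappa -> 0 <= eta <= PI -> 0 <= d -> 0 <= xi <= PI ->
  dir X = unit_vec (phi - turn_sign s1 * eta) ->
  Defs.pos X = circle_point kappa (turn_sign s1) c1 (phi - turn_sign s1 * eta) ->
  line_point (circle_point kappa (turn_sign s1) c1 phi) d phi =
    circle_point kappa (turn_sign s2) c2 phi ->
  dir Y = unit_vec (phi + turn_sign s2 * xi) ->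
  Defs.pos Y = circle_point kappa (turn_sign s2) c2 (phi + turn_sign s2 * xi) ->
  4 / kappa <= edist (turn_center kappa T X) (turn_center kappa T Y) ->
  eta / kappa + d + xi / kappa <= s ->
  joins kappa X Y s.
Proof.
  intros Hk He Hd Hx DX PX Hline DY PY HD Hs.
  set (sg := - turn_sign T).
  assert (Hsg : is_sign sg) by (unfold sg; destruct T; [left | right]; simpl; ring).
  assert (H1 : exists al a, 0 <= al /\ 0 <= a <= PI /\ al + a = eta /\
    phi - turn_sign s1 * eta = phi + sg * (al - a) /\
    (turn_sign s1 = sg /\ al = 0 \/ turn_sign s1 = - sg /\ a = 0)).
  { assert (HP := PI_RGT_0); unfold sg; destruct T, s1; simpl.
    1, 4: exists eta, 0; repeat split; try lra; right; split; lra.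
    all: exists 0, eta; repeat split; try lra; left; split; lra. }
  assert (H2 : exists b be, 0 <= be /\ 0 <= b <= PI /\ b + be = xi /\
    phi + turn_sign s2 * xi = phi + sg * (b - be) /\
    (turn_sign s2 = sg /\ be = 0 \/ turn_sign s2 = - sg /\ b = 0)).
  { assert (HP := PI_RGT_0); unfold sg; destruct T, s2; simpl.
    1, 4: exists 0, xi; repeat split; try lra; right; split; lra.
    all: exists xi, 0; repeat split; try lra; left; split; lra. }
  destruct H1 as (al & a & Hal & Ha & Ea & Ev & C1).
  destruct H2 as (b & be & Hbe & Hb & Eb & Ew & C2).
  assert (HC : turn_center kappa T Y = displace sg (turn_center kappa T X) phi
    (chord_u kappa a d b) (chord_v kappa a b)).
  { unfold turn_center; rewrite DX, DY, PX, PY, Ev, Ew.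
    replace (turn_sign T) with (- sg) by (unfold sg; ring).
    assert (L1 := f_equal fst Hline); assert (L2 := f_equal snd Hline).
    unfold line_point, circle_point in L1, L2; simpl in L1, L2.
    destruct c1 as [x1 y1], c2 as [x2 y2]; simpl in L1, L2.
    unfold displace, chord_u, chord_v, circle_point, unit_vec.
    apply injective_projections; simpl; unfold plus, scal; simpl; unfold mult; simpl.
    (* The segment equation expresses the second center through the first, leaving trigonometric
       identities. *)
    1: replace x2 with (x1 + turn_sign s1 / kappa * sin phi + d * cos phi
        - turn_sign s2 / kappa * sin phi) by lra.
    2: replace y2 with (y1 - turn_sign s1 / kappa * cos phi + d * sin phi
        + turn_sign s2 / kappa * cos phi) by lra.
    all: destruct C1 as [[E1 ->] | [E1 ->]], C2 as [[E2 ->] | [E2 ->]];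
      rewrite E1, E2, ?Rminus_0_r, ?Rminus_0_l, ?cos_plus, ?sin_plus,
        ?cos_sign, ?sin_sign, ?cos_neg, ?sin_neg, ?cos_0, ?sin_0 by exact Hsg;
      destruct Hsg as [Hsg | Hsg]; rewrite Hsg; field; lra. }
  assert (PX' := circle_point_turn_center kappa T X _ DX).
  assert (PY' := circle_point_turn_center kappa T Y _ DY).
  rewrite Ev in DX, PX'; rewrite Ew in DY, PY'.
  rewrite HC in PY', HD.
  replace (turn_sign T) with (- sg) in PX', PY' by (unfold sg; ring).
  refine (joins_of_heading _ _ _ _ _ _ _ _ PX' (eq_sym DX) PY' (eq_sym DY)
    (word_length_unbounded kappa sg (turn_center kappa T X)
       phi al a d b be s Hk Hsg Hal Ha Hd Hb Hbe _ _)).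
  - rewrite <- (edist_displace sg (turn_center kappa T X) phi) by exact Hsg.
    apply pow_incr; split; [|exact HD].
    apply Rdiv_le_0_compat; lra.
  - rewrite <- Ea, <- Eb in Hs; unfold Rdiv in *; lra.
Qed.

(** A segment is a word with all four angles [0]; its outer circles, taken on the right, have
    centers at distance [d]. *)
Lemma joins_of_long_segment (kappa d th s : R) (p : plane) :
  0 < kappa -> 4 / kappa <= d -> d <= s ->
  joins kappa (heading_point p th) (heading_point (line_point p d th) th) s.
Proof.
  intros Hk Hd Hs; assert (HP := PI_RGT_0).
  assert (H4 : 0 < 4 / kappa) by (apply Rdiv_lt_0_compat; lra).
  generalize (word_length_unbounded kappa 1
    (fst p + / kappa * sin th, snd p - / kappa * cos th) th 0 0 d 0 0 s
    Hk (or_introl eq_refl) ltac:(lra) ltac:(lra) ltac:(lra) ltac:(lra) ltac:(lra)).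
  unfold chord_u, chord_v; rewrite sin_0, cos_0; cbv zeta; intros J.
  refine (joins_of_heading _ _ _ _ _ _ _ _ _ _ _ _ (J _ _)).
  - unfold circle_point; destruct p as [x y]; simpl.
    replace (th + 1 * (0 - 0)) with th by ring; f_equal; field; lra.
  - simpl; f_equal; ring.
  - unfold circle_point, displace, line_point; destruct p as [x y]; simpl.
    replace (th + 1 * (0 - 0)) with th by ring; f_equal; field; lra.
  - simpl; f_equal; ring.
  - replace (2 / kappa * (0 + 0)) with 0 by ring; replace (1 - 1) with 0 by ring.
    rewrite Rplus_0_r, Rmult_0_r, (pow_i 2), Rplus_0_r by lia.
    apply pow_incr; lra.
  - unfold Rdiv; lra.
Qed.

Theorem proposition2 (kappa : R) (hkappa : 0 < kappa)
    (X Y : oriented_point) (hXY : X <> Y)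
    (gm : C1_path) (hgm : is_shortest kappa X Y gm)
    (hO : in_O kappa X Y gm)
    (s : R) (hs : path_length gm <= s) :
  exists g : C1_path, in_Gamma kappa X Y g /\ path_length g = s.
Proof.
  destruct hgm as [G _]; rewrite (in_Gamma_length _ _ _ _ G) in hs.
  assert (hdur := dur_gt0 gm).
  (* The length [s] is at least [dur gm > 0], which excludes the trivial alternative of [joins]. *)
  cut (joins kappa X Y s); [intros [(-> & _) | H]; [lra | exact H]|].
  destruct hO as (eta & d & xi & (He & Hd & Hx & Hdur & s1 & s2 & A1 & S & A2) & hO).
  destruct G as (_ & _ & P0 & V0 & P1 & V1 & _).
  assert (Hle : 0 <= eta / kappa) by (apply Rdiv_le_0_compat; lra).
  assert (Hlx : 0 <= xi / kappa) by (apply Rdiv_le_0_compat; lra).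
  destruct (exists_heading _ (dir_unit X)) as [th DX].
  set (phi := th + turn_sign s1 * eta).
  destruct (arc_endpoint kappa s1 eta 0 th gm) as (c1 & Q0 & Q1 & U1);
    [lra | exact He | lra | lra | exact A1 | congruence |].
  fold phi in Q1, U1; rewrite Rplus_0_l in Q1, U1.
  destruct (segment_endpoint d (eta / kappa) phi gm) as (Q2 & U2);
    [exact Hd | lra | lra | exact S | exact U1 |].
  destruct (arc_endpoint kappa s2 xi (eta / kappa + d) phi gm) as (c2 & Q3 & Q4 & U3);
    [lra | exact Hx | lra | lra | exact A2 | exact U2 |].
  rewrite <- Hdur, P1 in Q4; rewrite <- Hdur, V1 in U3; rewrite P0 in Q0.
  rewrite Q1, Q3 in Q2.
  assert (J1 : forall s, arc_joins kappa (turn_sign s1) eta s -> joins kappa X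
    (heading_point (circle_point kappa (turn_sign s1) c1 phi) phi) s).
  { intros l J; refine (joins_of_heading _ X (heading_point _ _) _ _ _ _ _
      (eq_sym Q0) (eq_sym DX) eq_refl eq_refl (J c1 th)). }
  assert (J2 : forall s,
    joins kappa (heading_point (circle_point kappa (turn_sign s1) c1 phi) phi)
      (heading_point (line_point (circle_point kappa (turn_sign s1) c1 phi) d phi) phi) s ->
    joins kappa (heading_point (circle_point kappa (turn_sign s1) c1 phi) phi)
      (heading_point (circle_point kappa (turn_sign s2) c2 phi) phi) s).
  { intros l; rewrite <- Q2; auto. }
  assert (J3 : forall s, arc_joins kappa (turn_sign s2) xi s -> joins kappa
    (heading_point (circle_point kappa (turn_sign s2) c2 phi) phi) Y s).
  { intros l J; refine (joins_of_heading _ (heading_point _ _) Y _ _ _ _ _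
      eq_refl eq_refl (eq_sym Q4) (eq_sym U3) (J c2 phi)). }
  (* Each of the three pieces may be replaced by a path with the same ends; only the lengths have to
     add up to [s]. *)
  assert (K : forall la ld lb, la + ld + lb = s ->
    arc_joins kappa (turn_sign s1) eta la ->
    joins kappa (heading_point (circle_point kappa (turn_sign s1) c1 phi) phi)
      (heading_point (line_point (circle_point kappa (turn_sign s1) c1 phi) d phi) phi) ld ->
    arc_joins kappa (turn_sign s2) xi lb -> joins kappa X Y s).
  { intros la ld lb <- Ka Kd Kb.
    exact (joins_trans _ _ _ _ _ _
      (joins_trans _ _ _ _ _ _ (J1 _ Ka) (J2 _ Kd)) (J3 _ Kb)). }
  assert (T1 := turn_is_sign s1); assert (T2 := turn_is_sign s2).
  assert (B1 := joins_arc kappa _ eta hkappa T1 He).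
  assert (B2 := joins_segment kappa d phi
    (circle_point kappa (turn_sign s1) c1 phi) hkappa Hd).
  assert (B3 := joins_arc kappa _ xi hkappa T2 Hx).
  (* An arc of at least a half turn takes all the surplus. Past these two cases both angles are
     below [PI], as the far-center case requires. *)
  destruct (Rle_lt_dec PI eta) as [He' | He'].
  { apply (K (s - (d + xi / kappa)) d (xi / kappa)); auto; [ring|].
    apply long_arc_joins; auto; lra. }
  destruct (Rle_lt_dec PI xi) as [Hx' | Hx'].
  { apply (K (eta / kappa) d (s - (eta / kappa + d))); auto; [ring|].
    apply long_arc_joins; auto; lra. }
  assert (F : forall T,
    4 / kappa <= edist (turn_center kappa T X) (turn_center kappa T Y) ->
    joins kappa X Y s).
  { intros T HT.
    apply (joins_of_far_centers kappa T s1 s2 X Y c1 c2 eta d xi phi s); auto; try lra.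
    - rewrite DX; unfold phi; f_equal; ring.
    - rewrite Q0; unfold phi; f_equal; ring. }
  destruct hO as [? | [? | [Hd' | [HC | HC]]]]; [lra | lra | | |];
    [| exact (F _ HC) | exact (F _ HC)].
  (* Both arcs are kept and the long segment takes the surplus. *)
  apply (K (eta / kappa) (s - (eta / kappa + xi / kappa)) (xi / kappa)); auto; [ring|].
  apply joins_of_long_segment; auto; lra.
Qed.
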